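(* Let $p>2$ be a prime and let $f(x)=a_0+a_1x+\cdots+a_mx^m$ be a polynomial of degree $m$ with coefficients in the $p$-adic integers $\mathbb{Z}_p$. Suppose $r_0\in\mathbb{Z}$ satisfies $f(r_0)\equiv 0\pmod p$ and $v_p(f'(r_0))=0$. Put $c_j=\frac{f^{(j)}(r_0)}{j!}$ for $j=0,1,\dots,m$ (and $c_j=0$ for $j>m$); note $1/c_1\in\mathbb{Z}_p$. Then the series \[ r=r_0+\sum_{n=0}^\infty\bigg[\sum_{k=0}^n\frac{(-1)^{n-k+1}}{c_1^k\,(n+1)!}\binom{2n+1}{n-k}B_{n+k,k}(1!\,c_1,2!\,c_2,\dots)\bigg]\Big(\frac{c_0}{c_1}\Big)^{n+1} \] converges in $\mathbb{Z}_p$, and $r$ is a $p$-adic root of $f$ lifting $r_0$.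
   Context: $v_p$ denotes the $p$-adic valuation. For a sequence $x_1,x_2,\dots$, the $(n,k)$-th partial Bell polynomial is $B_{n,k}(x_1,x_2,\dots)=\sum \frac{n!}{i_1!i_2!\cdots}\left(\frac{x_1}{1!}\right)^{i_1}\left(\frac{x_2}{2!}\right)^{i_2}\cdots$, the sum over all sequences $(i_1,i_2,\dots)$ of nonnegative integers with $i_1+i_2+\cdots=k$ and $i_1+2i_2+\cdots=n$ (with $B_{0,0}=1$). *)

(* Defs.v *)
From HB Require Import structures.
From mathcomp Require Import all_boot all_order all_algebra.
From mathcomp Require Import boolp classical_sets filter constructive_ereal.
From mathcomp Require Import topology sequences.

Set Implicit Arguments.
Unset Strict Implicit.
Unset Printing Implicit Defensive.
Import Order.TTheory GRing.Theory Num.Theory.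
Local Open Scope classical_set_scope.
Local Open Scope ring_scope.

(* The p-adic integers as the inverse limit of the rings Z/p^n: an element is *)
(* the coherent sequence of its residues in [0, p^n).  Coherence alone forces *)
(* padic_res n < p ^ n.                                                       *)
Record padic_int (p : nat) (pP : prime p) := PadicInt {
  padic_res :> nat -> nat;
  padic_resP : forall n, (padic_res n.+1 %% p ^ n)%N = padic_res n }.

Section PadicInt.
Variables (p : nat) (pP : prime p).
Local Notation Zp := (padic_int pP).
Implicit Types x y z : Zp.

HB.instance Definition _ := gen_eqMixin Zp.
HB.instance Definition _ := gen_choiceMixin Zp.

Lemma padic_pgt0 n : (0 < p ^ n)%N.
Proof. by rewrite expn_gt0 prime_gt0. Qed.

Lemma padic_res_lt x n : (x n < p ^ n)%N.
Proof. by rewrite -padic_resP ltn_pmod // padic_pgt0. Qed.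

Lemma padic_res_mod x n : (x n %% p ^ n)%N = x n.
Proof. by rewrite modn_small // padic_res_lt. Qed.

Lemma padic_eqP x y : (forall n, x n = y n %[mod p ^ n]) -> x = y.
Proof.
move=> exy; have {exy} : padic_res x = padic_res y.
  by apply/funext => n; rewrite -padic_res_mod exy padic_res_mod.
case: x y => [x xP] [y yP] /= E; rewrite -{}E in yP *.
by congr PadicInt; apply: Prop_irrelevance.
Qed.

Lemma modn_expS m n : ((m %% p ^ n.+1) %% p ^ n)%N = (m %% p ^ n)%N.
Proof. by rewrite modn_dvdm // dvdn_exp2l. Qed.

(* the p-adic integer whose n-th residue is f n reduced modulo p ^ n *)
Definition padic_mk (f : nat -> nat)
    (fP : forall n, f n.+1 = f n %[mod p ^ n]) : Zp.
Proof.
exists (fun n => f n %% p ^ n)%N => n.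
by rewrite modn_expS fP.
Defined.

Lemma padic_coh x n : x n.+1 = x n %[mod p ^ n].
Proof. by rewrite padic_resP padic_res_mod. Qed.

Lemma padic_addP x y n : (x n.+1 + y n.+1 = x n + y n %[mod p ^ n])%N.
Proof. by rewrite -modnDm !padic_resP. Qed.
Lemma padic_mulP x y n : (x n.+1 * y n.+1 = x n * y n %[mod p ^ n])%N.
Proof. by rewrite -modnMm !padic_resP. Qed.
Lemma padic_oppP x n :
  (p ^ n.+1 - x n.+1 = p ^ n - x n %[mod p ^ n])%N.
Proof.
apply/eqP; rewrite -(eqn_modDr (x n.+1)) subnK ?(ltnW (padic_res_lt _ _))//.
rewrite -modnDmr padic_resP subnK ?(ltnW (padic_res_lt _ _))//.
by rewrite modnn expnS modnMl.
Qed.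
Lemma padic_natP k n : (k = k %[mod p ^ n])%N. Proof. by []. Qed.

Definition padic_zero : Zp := padic_mk (padic_natP 0).
Definition padic_one : Zp := padic_mk (padic_natP 1).
Definition padic_add x y : Zp := padic_mk (padic_addP x y).
Definition padic_mul x y : Zp := padic_mk (padic_mulP x y).
Definition padic_opp x : Zp := padic_mk (padic_oppP x).

Lemma padic_addA : associative padic_add.
Proof.
by move=> x y z; apply: padic_eqP => n /=; rewrite !modn_mod modnDmr modnDml addnA.
Qed.
Lemma padic_addC : commutative padic_add.
Proof. by move=> x y; apply: padic_eqP => n /=; rewrite addnC. Qed.
Lemma padic_add0 : left_id padic_zero padic_add.
Proof. by move=> x; apply: padic_eqP => n /=; rewrite mod0n add0n modn_mod. Qed.
Lemma padic_addN : left_inverse padic_zero padic_opp padic_add.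
Proof.
move=> x; apply: padic_eqP => n /=.
by rewrite modn_mod modnDml subnK ?(ltnW (padic_res_lt _ _))// modnn !mod0n.
Qed.

HB.instance Definition _ := GRing.isZmodule.Build Zp
  padic_addA padic_addC padic_add0 padic_addN.

Lemma padic_mulA : associative padic_mul.
Proof.
by move=> x y z; apply: padic_eqP => n /=; rewrite !modn_mod modnMmr modnMml mulnA.
Qed.
Lemma padic_mulC : commutative padic_mul.
Proof. by move=> x y; apply: padic_eqP => n /=; rewrite mulnC. Qed.
Lemma padic_mul1 : left_id padic_one padic_mul.
Proof. by move=> x; apply: padic_eqP => n /=; rewrite modn_mod modnMml mul1n. Qed.
Lemma padic_mulD : left_distributive padic_mul padic_add.
Proof.
move=> x y z; apply: padic_eqP => n /=.
by rewrite !modn_mod modnMml modnDmr modnDml mulnDl.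
Qed.
Lemma padic_one_neq0 : padic_one != 0.
Proof.
apply/eqP => /(congr1 (fun x : Zp => padic_res x 1)) /=.
by rewrite mod0n modn_small // expn1 prime_gt1.
Qed.

HB.instance Definition _ := GRing.Zmodule_isComNzRing.Build Zp
  padic_mulA padic_mulC padic_mul1 padic_mulD padic_one_neq0.

Definition padic_unit : pred Zp := [pred x | `[< exists y : Zp, y * x = 1 >]].
Definition padic_inv x : Zp :=
  if x \in padic_unit then xget 0 [set y : Zp | y * x = 1] else x.

Lemma padic_mulV : {in padic_unit, left_inverse 1 padic_inv *%R}.
Proof.
by move=> x ux; rewrite /padic_inv ux; move: ux => /asboolP; exact: xgetPex.
Qed.
Lemma padic_unitPl x y : y * x = 1 -> padic_unit x.
Proof. by move=> yx; apply/asboolP; exists y. Qed.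
Lemma padic_inv_out : {in [predC padic_unit], padic_inv =1 id}.
Proof. by move=> x; rewrite inE /padic_inv => /negbTE ->. Qed.

HB.instance Definition _ := GRing.ComNzRing_hasMulInverse.Build Zp
  padic_mulV padic_unitPl padic_inv_out.

Lemma padic_neq0 x : x != 0 -> exists n, ~~ (p ^ n %| x n)%N.
Proof.
move=> /eqP x0; apply: contrapT => /forallNP xn; apply: x0.
by apply: padic_eqP => n /=; rewrite !mod0n; apply/eqP/negPn/negP => /xn.
Qed.

Lemma padic_dvd_res x m n : (m <= n)%N -> (p ^ m %| x n)%N = (p ^ m %| x m)%N.
Proof.
move=> /subnKC <-; elim: (n - m)%N => [|k IH]; first by rewrite addn0.
rewrite addnS -{}IH -[x (m + k)%N]padic_resP.
by rewrite [RHS]/dvdn modn_dvdm // dvdn_exp2l // leq_addr.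
Qed.

Lemma padic_integral x y : x * y = 0 -> (x == 0) || (y == 0).
Proof.
move=> xy0; apply: contrapT => /negP; rewrite negb_or => /andP[].
move=> /padic_neq0[i xi] /padic_neq0[j yj].
have [x0|x0] := posnP (x (i + j)%N).
  by move: xi; rewrite -(padic_dvd_res x (leq_addr j i)) x0 dvdn0.
have [y0|y0] := posnP (y (i + j)%N).
  by move: yj; rewrite -(padic_dvd_res y (leq_addl i j)) y0 dvdn0.
move: xi; rewrite -(padic_dvd_res x (leq_addr j i)) pfactor_dvdn // -ltnNge => xi.
move: yj; rewrite -(padic_dvd_res y (leq_addl i j)) pfactor_dvdn // -ltnNge => yj.
have : (p ^ (i + j) %| x (i + j) * y (i + j))%N.
  rewrite /dvdn; apply/eqP.
  by move/(congr1 (fun z : Zp => padic_res z (i + j))): xy0 => /= ->; rewrite mod0n.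
rewrite pfactor_dvdn ?muln_gt0 ?x0 // lognM // leqNgt.
by rewrite (leq_trans _ (leq_add xi (ltnW yj))) // addSn ltnS leqnn.
Qed.

HB.instance Definition _ := GRing.ComUnitRing_isIntegral.Build Zp padic_integral.

(* x = y mod p ^ n in Z_p *)
Definition padic_eqmod (n : nat) x y := exists z : Zp, x - y = (p ^ n)%:R * z.

(* The p-adic topology: the classes modulo p ^ n are a basis of               *)
(* neighbourhoods.                                                            *)
Definition padic_nbhs x : set_system Zp :=
  filter_from setT (fun n => [set y | padic_eqmod n y x]).

HB.instance Definition _ := hasNbhs.Build Zp padic_nbhs.

Lemma padic_eqmod_refl n x : padic_eqmod n x x.
Proof. by exists 0; rewrite subrr mulr0. Qed.

Lemma padic_eqmod_trans n x y z :
  padic_eqmod n x y -> padic_eqmod n y z -> padic_eqmod n x z.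
Proof.
move=> [a xy] [b yz]; exists (a + b).
by rewrite -(subrK y x) xy mulrDr -yz addrA.
Qed.

Lemma padic_eqmod_le m n x y :
  (m <= n)%N -> padic_eqmod n x y -> padic_eqmod m x y.
Proof.
move=> mn [z xy]; exists ((p ^ (n - m))%:R * z).
by rewrite mulrA -natrM -expnD subnKC.
Qed.

Lemma padic_nbhs_filter x : ProperFilter (padic_nbhs x).
Proof.
apply: filter_from_proper; last by move=> n _; exists x; exact: padic_eqmod_refl.
apply: filter_from_filter; first by exists 0%N.
move=> i j _ _; exists (maxn i j) => // y /= xy; split.
  by apply: padic_eqmod_le xy; rewrite leq_maxl.
by apply: padic_eqmod_le xy; rewrite leq_maxr.
Qed.
Lemma padic_nbhs_singleton x (A : set Zp) : padic_nbhs x A -> A x.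
Proof. by move=> [n _]; apply; exact: padic_eqmod_refl. Qed.
Lemma padic_nbhs_nbhs x (A : set Zp) :
  padic_nbhs x A -> padic_nbhs x (padic_nbhs^~ A).
Proof.
move=> [n _ nA]; exists n => // y /= yx; exists n => // z /= zy.
by apply: nA; apply: padic_eqmod_trans zy yx.
Qed.

HB.instance Definition _ := Nbhs_isNbhsTopological.Build Zp
  padic_nbhs_filter padic_nbhs_singleton padic_nbhs_nbhs.

Definition padic : fieldType := {fraction Zp}.
Definition padic_of_int x : padic := FracField.tofrac x.

(* v_p on Q_p with values in the integers extended by v_p(0) = +oo: k is the  *)
(* unique integer such that x = p ^ k * u with u a unit of Z_p.               *)
Definition padic_val (x : padic) : \bar int :=
  if x == 0 then +oo%E
  else (xget 0 [set k : int | exists2 u : Zp,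
    u \is a GRing.unit & x = p%:R ^ k * padic_of_int u])%:E.

Lemma padic_natE k n : padic_res (k%:R : Zp) n = (k %% p ^ n)%N.
Proof.
elim: k => [|k IH]; first by rewrite mulr0n.
rewrite -addn1 natrD.
transitivity (((k%:R : Zp) n + (1%R : Zp) n) %% p ^ n)%N; first by [].
by rewrite IH /= modnDm.
Qed.

Lemma padic_unitE x : (x \is a GRing.unit) = ~~ (p %| x 1)%N.
Proof.
apply/idP/idP => [/divrr x1|px].
  apply/negP => /dvdnP[q xq].
  move/(congr1 (fun z : Zp => padic_res z 1)): x1 => /=.
  by rewrite xq expn1 -mulnA mulnCA modnMr modn_small // prime_gt1.
have cop n : coprime (x n) (p ^ n).
  case: n => [|n]; first by rewrite expn0 coprimen1.
  rewrite coprime_sym coprime_pexpl // prime_coprime //.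
  by move: (padic_dvd_res x (ltn0Sn n)); rewrite expn1 => ->.
have inv n : exists a : nat, (a * x n = 1 %[mod p ^ n])%N.
  have [xn0|xn0] := posnP (x n).
    exists 0%N; move: (cop n); rewrite xn0 /coprime gcd0n => /eqP ->.
    by rewrite !modn1.
  have [a b ab _] := egcdnP (p ^ n) xn0.
  by exists a; rewrite ab (eqP (cop n)) modnMDl.
have [g gP] := boolp.choice inv.
have gcoh n : g n.+1 = g n %[mod p ^ n].
  have e1 : (g n.+1 * x n = 1 %[mod p ^ n])%N.
    rewrite -padic_resP modnMmr -modn_expS gP modn_expS //.
  rewrite -[g n.+1]muln1 -modnMmr -(gP n) modnMmr mulnCA -modnMmr e1 modnMmr.
  by rewrite muln1.
apply: (@padic_unitPl x (padic_mk gcoh)); apply: padic_eqP => n /=.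
by rewrite modnMml !modn_mod gP.
Qed.

Lemma padic_factor x : x != 0 ->
  exists k : nat, exists2 u : Zp, u \is a GRing.unit & x = p%:R ^+ k * u.
Proof.
move=> /padic_neq0 ex; case: (ex_minnP ex) => [[|k]]; first by rewrite dvd1n.
move=> xk kmin; have xk0 : (p ^ k %| x k)%N.
  by apply/negPn/negP => /kmin; rewrite ltnn.
have dvd n : (p ^ k %| x (n + k))%N by rewrite padic_dvd_res ?leq_addl.
have ucoh n : (x (n.+1 + k) %/ p ^ k = x (n + k) %/ p ^ k %[mod p ^ n])%N.
  by rewrite !modn_divl -expnD addSn padic_resP padic_res_mod.
exists k, (padic_mk ucoh).
  rewrite padic_unitE /= expn1.
  apply: contra xk; rewrite {1}/dvdn modn_mod -/(dvdn _ _) => pu.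
  by rewrite -(divnK (dvd 1%N)) expnS dvdn_pmul2r ?padic_pgt0.
apply: padic_eqP => n; rewrite -natrX.
transitivity ((((p ^ k)%:R : Zp) n * (padic_mk ucoh) n) %% p ^ n)%N; last first.
  by rewrite -[LHS]modn_mod.
rewrite padic_natE /= modnMml modnMmr mulnC divnK //.
elim: k {kmin xk xk0 dvd ucoh} => [|k IH]; first by rewrite addn0.
by rewrite {}IH addnS -[x (n + k)%N]padic_resP modn_dvdm // dvdn_exp2l // leq_addr.
Qed.

Lemma padic_val0 : padic_val 0 = +oo%E. Proof. by rewrite /padic_val eqxx. Qed.

Lemma padic_p_neq0 : (p%:R : Zp) != 0.
Proof.
apply/eqP => /(congr1 (fun z : Zp => padic_res z 2)).
rewrite padic_natE /= mod0n modn_small; last first.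
  by rewrite -{1}(expn1 p) ltn_exp2l // prime_gt1.
by move=> p0; move: (prime_gt0 pP); rewrite p0.
Qed.

Lemma padic_pnum_neq0 : (p%:R : padic) != 0.
Proof. by rewrite -(rmorph_nat (@FracField.tofrac Zp)) tofrac_eq0 padic_p_neq0. Qed.

Lemma padic_valE (k : int) (u : Zp) : u \is a GRing.unit ->
  padic_val (p%:R ^ k * padic_of_int u) = k%:E.
Proof.
move=> uu; have u0 : padic_of_int u != 0.
  by rewrite tofrac_eq0; apply: contraTneq uu => ->; rewrite unitr0.
rewrite /padic_val mulf_eq0 expfz_eq0 (negbTE padic_pnum_neq0) andbF (negbTE u0).
congr EFin; set P := [set _ | _].
have uniq (a b : int) (v w : Zp) : (a <= b)%R -> v \is a GRing.unit ->
    p%:R ^ a * padic_of_int v = p%:R ^ b * padic_of_int w -> a = b.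
  move=> ab uv e; apply/eqP; rewrite eq_le ab leNgt; apply/negP => ltab.
  have [n bn] : exists n : nat, b = a + n.+1%:Z.
    exists `|b - a|.-1; rewrite prednK ?absz_gt0 ?subr_eq0 ?gt_eqF //.
    by rewrite gez0_abs ?subr_ge0 // [RHS]addrC subrK.
  move: e; rewrite bn expfzDr ?padic_pnum_neq0 // -mulrA => /mulfI.
  rewrite expfz_eq0 (negbTE padic_pnum_neq0) andbF => /(_ isT).
  rewrite /exprz /padic_of_int -(rmorph_nat (@FracField.tofrac Zp)) -rmorphXn -rmorphM.
  move=> /eqP; rewrite tofrac_eq => /eqP vE; move: uv.
  rewrite vE exprS -mulrA unitrM padic_unitE padic_natE expn1 modnn dvdn0.
  by [].
have : P (xget 0 P) by apply: xgetPex; exists k; exists u.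
move=> [v uv e]; case/orP: (le_total (xget 0 P) k) => le.
  by apply: (uniq _ _ _ _ le uv); rewrite -e.
by apply/esym; apply: (uniq _ _ _ _ le uu); rewrite e.
Qed.

End PadicInt.

Arguments padic_of_int {p pP}.

(* The partial Bell polynomial B_{n,k}(x_1, x_2, ...); x 0 is not used.  The  *)
(* constraint i_1 + 2 i_2 + ... = n forces i_j <= n for all j and i_j = 0 for *)
(* j > n, so i is a function from 'I_n to 'I_n.+1 where i_(j+1) is i j.       *)
Definition partial_bell (F : fieldType) (n k : nat) (x : nat -> F) : F :=
  \sum_(i : {ffun 'I_n -> 'I_n.+1} |
      ((\sum_(j < n) i j == k) && (\sum_(j < n) j.+1 * i j == n))%N)
    (n`!%:R / (\prod_(j < n) (i j)`!)%N%:R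
     * \prod_(j < n) (x j.+1 / j.+1`!%:R) ^+ i j).

Definition taylor_coef (p : nat) (pP : prime p) (f : {poly padic_int pP})
    (r0 : int) (j : nat) : padic pP :=
  padic_of_int (f^`(j)).[r0%:~R] / j`!%:R.

Definition root_term (p : nat) (pP : prime p) (f : {poly padic_int pP})
    (r0 : int) (n : nat) : padic pP :=
  let c := taylor_coef f r0 in
  (\sum_(0 <= k < n.+1)
     ((-1) ^+ (n - k + 1) / (c 1%N ^+ k * n.+1`!%:R) * 'C(2 * n + 1, n - k)%:R
      * partial_bell (n + k) k (fun j => j`!%:R * c j)))
  * (c 0%N / c 1%N) ^+ n.+1.

(* Main.v *)
Require Import Defs.
From mathcomp Require Import all_boot all_order all_algebra.
From mathcomp Require Import boolp classical_sets filter constructive_ereal.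
From mathcomp Require Import topology sequences.
From mathcomp Require Import ring.

(* Write f(r0 + y) = c_0 + c_1 y H(y) with H(0) = 1 and u = c_0 / c_1, so that *)
(* a root r0 + y amounts to y H(y) = - u.  The compositional inverse           *)
(* sum_n b_n X^(n+1) of X H has coefficients in Z_p, and a solution y in p Z_p *)
(* (Hensel) must be sum_n b_n (- u)^(n+1).  By Lagrange inversion (n + 1) b_n  *)
(* is the coefficient of X^n in H^(-(n+1)).  As H - 1 has no constant term,    *)
(* modulo X^(n+1) this power is sum_(j <= n) C(n+j, n) (1 - H)^j, which        *)
(* expands as sum_(k <= n) (-1)^k C(n+k, k) C(2n+1, n-k) H^k.  The coefficient *)
(* of X^n in H^k is, up to c_1^k (n+k)! / k!, the Bell polynomial B_(n+k,k).   *)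

Set Implicit Arguments.
Unset Strict Implicit.
Unset Printing Implicit Defensive.
Import GRing.Theory.
Local Open Scope classical_set_scope.
Local Open Scope ring_scope.

(** The argument runs on polynomials with explicit remainders. By [inv_coefP], the inverse of X H
    cut at degree N, composed with X H, is X + X^(N+1) S with S over Z_p. At the point x of p Z_p
    with x H(x) = - u, given by [hensel_monic], this says that the N-th partial sum differs from x
    by a multiple of p^(N+1). That the summands are those of the stated series is [root_termE],
    which joins [inv_coefE] (Lagrange inversion) to [partial_bellE]. The b_n come from a recursion
    without division, so the terms lie in Z_p despite the factorials in their denominators. *)

(** * Binomial sums and truncated powers of 1 / (1 - x) *)

(** For k <= j both sides are the multinomial (n+j)! / (n! k! (j-k)!); otherwise both vanish. *)
Lemma mul_bin_trinomial n j k :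
  ('C(n + j, n) * 'C(j, k) = 'C(n + k, k) * 'C(n + j, n + k))%N.
Proof.
have [jk|kj] := ltnP j k; 
  first by rewrite (bin_small jk) (@bin_small _ (n + k)) ?muln0 // ltn_add2l.
apply/eqP; rewrite -(eqn_pmul2r (fact_gt0 n)) -(eqn_pmul2r (fact_gt0 k)).
rewrite -(eqn_pmul2r (fact_gt0 (j - k))); apply/eqP.
have e1 := bin_fact (leq_addr j n); rewrite addKn in e1.
have e2 := bin_fact kj.
have e3 := bin_fact (leq_addl n k); rewrite addnK in e3.
have e4 : (n + k <= n + j)%N by rewrite leq_add2l.
have {e4} := bin_fact e4; rewrite subnDl => e4.
transitivity ((n + j)`!)%N.
  rewrite -e1 -e2; ring.
rewrite -e4 -e3; ring.
Qed.

Lemma sum_bin_upper n k L :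
  (\sum_(j < L) 'C(n + j, n + k) = 'C(n + L, (n + k).+1))%N.
Proof.
elim: L => [|L IH]; first by rewrite big_ord0 bin_small // addn0 ltnS leq_addr.
by rewrite big_ord_recr /= IH addnS binS.
Qed.

Section ReciprocalPower.
Variable R : comNzRingType.
Implicit Types x z : R.

(** Truncated form of (1 - x) (1 - x)^(-(n+2)) = (1 - x)^(-(n+1)), by Pascal's rule. *)
Lemma mul_sum_bin n L x :
  (1 - x) * \sum_(j < L) 'C(n.+1 + j, n.+1)%:R * x ^+ j =
  \sum_(j < L) 'C(n + j, n)%:R * x ^+ j - 'C(n + L, n.+1)%:R * x ^+ L.
Proof.
elim: L => [|L IH].
  by rewrite !big_ord0 addn0 bin_small // mul0r mulr0 subr0.
rewrite !big_ord_recr /= mulrDr IH addSn addnS binS natrD exprS; ring.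
Qed.

Lemma sum_bin_reciprocal n L x : exists y,
  (1 - x) ^+ n.+1 * (\sum_(j < L) 'C(n + j, n)%:R * x ^+ j) = 1 + x ^+ L * y.
Proof.
elim: n => [|n [y IH]].
  exists (-1); elim: L => [|L IH]; first by rewrite big_ord0; ring.
  by rewrite big_ord_recr /= mulrDr IH bin0 expr1 exprS; ring.
exists (y - 'C(n + L, n.+1)%:R * (1 - x) ^+ n.+1).
by rewrite exprSr -mulrA mul_sum_bin mulrBr IH; ring.
Qed.

(** Once (1 - z)^j is expanded, [mul_bin_trinomial] pulls C(n+k, k) out of the sum over j, and the
    hockey-stick identity [sum_bin_upper] leaves C(2n+1, n+k+1) = C(2n+1, n-k). *)
Lemma sum_bin_reciprocalE n z :
  \sum_(j < n.+1) 'C(n + j, n)%:R * (1 - z) ^+ j =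
  \sum_(k < n.+1) (-1) ^+ k * ('C(n + k, k) * 'C(2 * n + 1, n - k))%:R * z ^+ k.
Proof.
have binE (j : 'I_n.+1) :
    (1 - z) ^+ j = \sum_(k < n.+1) (-1) ^+ k * 'C(j, k)%:R * z ^+ k.
  rewrite addrC exprD1n.
  rewrite (big_ord_widen n.+1 (fun k => (- z) ^+ k *+ 'C(j, k))) ?ltn_ord //.
  rewrite big_mkcond; apply: eq_bigr => k _; case: ltnP => [_|jk].
    by rewrite [in LHS]exprNn -mulr_natr mulrAC.
  by rewrite bin_small // mulr0 mul0r.
under eq_bigr do rewrite binE mulr_sumr.
rewrite exchange_big; apply: eq_bigr => k _ /=.
have kn : (k <= n)%N by rewrite -ltnS.
have -> : ('C(n + k, k) * 'C(2 * n + 1, n - k) =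
           \sum_(j < n.+1) 'C(n + j, n) * 'C(j, k))%N.
  under eq_bigr do rewrite mul_bin_trinomial.
  rewrite -big_distrr /= sum_bin_upper; congr (_ * _)%N.
  have e2 : (2 * n + 1 = n + n.+1)%N by rewrite mul2n addn1 addnS addnn.
  have le : ((n + k).+1 <= n + n.+1)%N by rewrite -addnS leq_add2l.
  by rewrite -(bin_sub le) e2 -[(n + k).+1]addnS subnDl subSS.
rewrite natr_sum mulr_sumr mulr_suml; apply: eq_bigr => j _.
by rewrite natrM !mulrA [_ * (-1) ^+ k]mulrC.
Qed.

End ReciprocalPower.

(** * Compositional inverse of X H and Lagrange inversion *)

Section Inversion.
Variable R : comNzRingType.
Implicit Types H : {poly R}.

(* [- (inv_rem H N)`_0] is the coefficient of [X^(N+1)] in the compositional *)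
(* inverse of [X H], and [X^(N+1) (inv_rem H N)] is the error made by the    *)
(* truncation of this inverse at degree [N].                                 *)
Fixpoint inv_rem H N : {poly R} :=
  if N is N'.+1 then
    drop_poly 1 (inv_rem H N' - (inv_rem H N')`_0 *: H ^+ N)
  else -1.

Definition inv_coef H N : R := - (inv_rem H N)`_0.

Lemma inv_coefP H N : H`_0 = 1 ->
  \sum_(k < N) inv_coef H k *: ('X * H) ^+ k.+1 = 'X + 'X^(N.+1) * inv_rem H N.
Proof.
move=> H0; elim: N => [|N IH].
  by rewrite big_ord0 /= expr1 mulrN1 subrr.
rewrite big_ord_recr {}IH [inv_rem H N.+1]/=.
set S := inv_rem H N; set D := S - _.
(* As H(0) = 1, the new term cancels the constant coefficient, so dropping it is an exact division
   by X. *)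
have D0 : D`_0 = 0.
  rewrite coefB coefZ -[(H ^+ _)`_0]horner_coef0 horner_exp horner_coef0.
  by rewrite H0 expr1n mulr1 subrr.
have -> : 'X^(N.+2) * drop_poly 1 D = 'X^(N.+1) * D.
  rewrite -[in RHS](poly_take_drop 1 D) exprSr expr1.
  have -> : take_poly 1 D = 0.
    by apply/polyP => i; rewrite coef_take_poly coef0; case: i.
  by rewrite add0r; ring.
by rewrite /D /inv_coef -/S scaleNr exprMn -!mul_polyC /=; ring.
Qed.

End Inversion.

Section Lagrange.
Variables (R : idomainType) (R0 : forall n, (n.+1%:R : R) != 0).
Implicit Types H I : {poly R}.

(** Since I stands for H^(-(n+1)), this coefficient is the residue of (X H)^(-d-1) (X H)', the
    derivative of - (X H)^(-d) / d; a derivative has residue zero. *)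
Lemma coef_residue H I U n k d : (0 < d)%N -> (k + d = n)%N ->
  H ^+ n.+1 * I = 1 + 'X^(n.+1) * U ->
  (H ^+ k * ('X * H)^`() * I)`_d = 0.
Proof.
case: d => // d _ kd HI; pose J := H ^+ k.+1 * I.
have JH : J * H ^+ d.+1 = 1 + 'X^(n.+1) * U.
  by rewrite -HI -kd /J mulrAC -exprD addSn.
have := congr1 (fun P => J * P^`()) JH.
have d1 : (1 : {poly R})^`() = 0 by exact: derivC.
rewrite derivM deriv_exp /= derivD d1 add0r derivM derivXn /= => e.
(* J stands for H^(-(d+1)): differentiating J H^(d+1) = 1 modulo X^(n+1) and multiplying by J gives
   a relation modulo X^n, which reaches the coefficient of X^d because d < n. *)
have {}e : J^`() + (H ^+ k * H^`() * I) *+ d.+1 =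
   'X^n * (J * (U *+ n.+1 + 'X * U^`())
           - 'X * U * (J^`() + (H ^+ k * H^`() * I) *+ d.+1)).
  rewrite mulrBr; apply/eqP; rewrite eq_sym subr_eq; apply/eqP.
  transitivity (J * ('X^n *+ n.+1 * U + 'X^(n.+1) * U^`())).
    by rewrite exprS; ring.
  rewrite -e.
  transitivity (J^`() * (J * H ^+ d.+1)
                + (H ^+ n.+1 * I) * (H ^+ k * H^`() * I) *+ d.+1).
    have -> : H ^+ n.+1 = H ^+ k.+1 * H ^+ d.+1 by rewrite -exprD addSn kd.
    by rewrite /J !exprS; ring.
  by rewrite JH HI exprS; ring.
have := congr1 (fun P : {poly R} => P`_d) e.
rewrite coefXnM -kd addnS ltnS leq_addl coefD coef_deriv coefMn -mulrnDl => /eqP.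
rewrite -mulr_natr mulf_eq0 (negbTE (R0 _)) orbF => /eqP e0.
have -> : H ^+ k * ('X * H)^`() * I = J + 'X * (H ^+ k * H^`() * I).
  by rewrite derivM derivX /J exprS; ring.
by rewrite coefD coefXM.
Qed.

(** Differentiate [inv_coefP], multiply by I and take the coefficient of X^n: [coef_residue] kills
    every summand except k = n. *)
Lemma lagrange_inversion H I U n : H`_0 = 1 ->
  H ^+ n.+1 * I = 1 + 'X^(n.+1) * U ->
  n.+1%:R * inv_coef H n = I`_n.
Proof.
move=> H0 HI.
have := congr1 (fun P => (P^`() * I)`_n) (inv_coefP n.+1 H0).
move: (inv_rem H n.+1) => S.
rewrite derivD derivX derivM derivXn /= mulrDl mul1r coefD.
have -> : ('X^(n.+1) *+ n.+2 * S + 'X^(n.+2) * S^`()) * I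
    = 'X^(n.+1) * ((S *+ n.+2 + 'X * S^`()) * I) by rewrite !exprS; ring.
rewrite coefXnM ltnSn addr0 => <-.
rewrite (raddf_sum (@deriv R)) mulr_suml coef_sum.
have termE (k : nat) : (k <= n)%N ->
  ((inv_coef H k *: ('X * H) ^+ k.+1)^`() * I)`_n =
  k.+1%:R * inv_coef H k * (H ^+ k * ('X * H)^`() * I)`_(n - k).
  move=> kn; rewrite derivZ deriv_exp /= -scalerAl coefZ.
  have -> : ('X * H)^`() * ('X * H) ^+ k *+ k.+1 * I
     = 'X^k * (H ^+ k * ('X * H)^`() * I) *+ k.+1.
    by rewrite exprMn; ring.
  rewrite coefMn coefXnM ltnNge kn /= -mulr_natr; ring.
rewrite big_ord_recr /= termE // subnn big1 ?add0r => [|k _]; last first.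
  rewrite termE 1?ltnW // (coef_residue (n := n) _ _ HI) ?mulr0 ?subn_gt0 //.
  by rewrite subnKC // ltnW.
have -> : H ^+ n * ('X * H)^`() * I = 1 + 'X * ('X^n * U + H ^+ n * H^`() * I).
  rewrite derivM derivX; move: HI; rewrite !exprS => HI.
  transitivity (H * H ^+ n * I + 'X * (H ^+ n * H^`() * I)); first by ring.
  by rewrite HI; ring.
by rewrite coefD coef1 coefXM eqxx addr0 mulr1.
Qed.

Lemma inv_coefE H n : H`_0 = 1 ->
  n.+1%:R * inv_coef H n =
  \sum_(k < n.+1)
    (-1) ^+ k * ('C(n + k, k) * 'C(2 * n + 1, n - k))%:R * (H ^+ k)`_n.
Proof.
move=> H0; have [y] := sum_bin_reciprocal n n.+1 (1 - H).
rewrite (_ : 1 - (1 - H) = H); last by ring.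
have [K eK] : exists K, 1 - H = 'X * K.
  exists (drop_poly 1 (1 - H)).
  rewrite -[LHS](poly_take_drop 1) expr1 mulrC.
  have -> : take_poly 1 (1 - H) = 0.
    by apply/polyP => -[|i]; rewrite coef_take_poly coef0 //= coefB coef1 H0 subrr.
  by rewrite add0r.
set I := \sum_(_ < _) _ => HI.
have -> : n.+1%:R * inv_coef H n = I`_n.
  by apply: (@lagrange_inversion _ _ (K ^+ n.+1 * y)); rewrite // HI eK exprMn mulrA.
rewrite /I sum_bin_reciprocalE coef_sum; apply: eq_bigr => k _.
by rewrite -(rmorph_nat polyC) -(rmorphN1 polyC) -rmorphXn /= -polyCM coefCM.
Qed.
End Lagrange.

(** * Bell polynomials as coefficients of powers *)

Section Bell.
Variables (F : fieldType) (F0 : forall n, (n.+1%:R : F) != 0).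

Lemma fact_neq0 n : (n`!%:R : F) != 0.
Proof. by rewrite -(prednK (fact_gt0 n)). Qed.

(** This is exp(x T) modulo T^B, with T the indeterminate. *)
Definition trunc_exp (A : comAlgType F) (B : nat) (x : A) : {poly A} :=
  \poly_(i < B) ((i`!%:R^-1 : F) *: x ^+ i).

Lemma coef_prod_trunc_exp (A : comAlgType F) B M (x : nat -> A) k : (k < B)%N ->
  (\prod_(j < M) trunc_exp B (x j))`_k =
  (k`!%:R^-1 : F) *: (\sum_(j < M) x j) ^+ k.
Proof.
elim: M k => [|M IH] k kB.
  rewrite !big_ord0 coef1 expr0n; case: k kB => [|k] _ /=; last by rewrite scaler0.
  by rewrite fact0 invr1 scale1r.
rewrite !big_ord_recr /= coefMr exprDn scaler_sumr; apply: eq_bigr => i _.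
have ik : (i <= k)%N by rewrite -ltnS.
rewrite coef_poly (leq_ltn_trans ik kB) IH ?(leq_ltn_trans (leq_subr _ _)) //.
rewrite -scalerAl -scalerAr scalerA -scaler_nat scalerA; congr (_ *: _).
apply: (mulIf (fact_neq0 k)); rewrite [RHS]mulrAC mulVf ?fact_neq0 // mul1r.
by rewrite -{1}(bin_fact ik) !natrM; field; rewrite !fact_neq0.
Qed.

(* Both sides are the coefficient of T^k in the product of the exp(x_j T). *)
Lemma expr_sum_multinomial (A : comAlgType F) B M (x : nat -> A) k : (k < B)%N ->
  (k`!%:R^-1 : F) *: (\sum_(j < M) x j) ^+ k =
  \sum_(i : {ffun 'I_M -> 'I_B} | (\sum_(j < M) i j == k)%N)
    ((\prod_(j < M) (i j)`!)%N%:R^-1 : F) *: \prod_(j < M) x j ^+ i j.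
Proof.
move=> kB; rewrite -(coef_prod_trunc_exp M x kB) /trunc_exp.
under eq_bigr do rewrite poly_def.
rewrite bigA_distr_bigA coef_sum [RHS]big_mkcond; apply: eq_bigr => i _ /=.
have -> : \prod_(j < M) (((i j)`!%:R^-1 : F) *: x j ^+ i j *: 'X^(i j)) =
   (((\prod_(j < M) (i j)`!)%N%:R^-1 : F) *: \prod_(j < M) x j ^+ i j)
    *: 'X^(\sum_(j < M) i j).
  by rewrite natr_prod -prodfV !scaler_prod prodrXr.
by rewrite coefZ coefXn eq_sym; case: eqP; rewrite ?mulr1 ?mulr0.
Qed.

(** Expand the k-th power of c_1 X + ... + c_n X^n by the multinomial theorem: the coefficient of
    X^n selects the weight condition of the Bell polynomial. With k <= n, the exponents fit in
    ['I_n.+1]. *)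
Lemma partial_bellE n k (c : nat -> F) (h : {poly F}) :
  h`_0 = 0 -> (forall j, (0 < j)%N -> h`_j = c j) -> (k <= n)%N ->
  partial_bell n k (fun j => j`!%:R * c j) = n`!%:R / k`!%:R * (h ^+ k)`_n.
Proof.
move=> h0 hc kn; rewrite /partial_bell.
pose h' := \sum_(j < n) c j.+1 *: 'X^(j.+1).
have -> : (h ^+ k)`_n = (h' ^+ k)`_n.
  have [q ->] : exists q, h = h' + 'X^(n.+1) * q.
    exists (drop_poly n.+1 h); rewrite -[LHS](poly_take_drop n.+1) [_ * 'X^_]mulrC.
    congr (_ + _); rewrite /take_poly poly_def big_ord_recl /= h0 scale0r add0r.
    by apply: eq_bigr => j _; rewrite hc.
  have [r ->] : exists r, (h' + 'X^(n.+1) * q) ^+ k = h' ^+ k + 'X^(n.+1) * r.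
    elim: k {kn} => [|k [r IH]]; first by exists 0; rewrite mulr0 addr0.
    exists (r * h' + (h' ^+ k + 'X^(n.+1) * r) * q).
    by rewrite exprSr IH [h' ^+ k.+1]exprSr; ring.
  by rewrite coefD coefXnM ltnSn addr0.
have := congr1 (fun P : {poly F} => n`!%:R * P`_n)
  (expr_sum_multinomial n (fun j => c j.+1 *: 'X^(j.+1)) (kn : (k < n.+1)%N)).
rewrite coefZ mulrA => ->.
rewrite coef_sum mulr_sumr big_mkcondr /=.
apply: eq_bigr => i _.
have -> : \prod_(j < n) (c j.+1 *: 'X^(j.+1)) ^+ i j =
   (\prod_(j < n) c j.+1 ^+ i j) *: 'X^(\sum_(j < n) j.+1 * i j).
  elim/big_rec3: _ => [|j a b d _ ->]; first by rewrite expr0 scale1r.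
  by rewrite exprD exprZn -exprM -!mul_polyC polyCM; ring.
rewrite !coefZ coefXn eq_sym; case: eqP => _; last by rewrite !mulr0.
rewrite mulr1 mulrA; congr (_ * _); apply: eq_bigr => j _.
by rewrite mulrAC divff ?mul1r // fact_neq0.
Qed.
End Bell.

(** * Congruences, completeness and Hensel lifting in Z_p *)

Section PadicFacts.
Variables (p : nat) (pP : prime p).
Local Notation Zp := (padic_int pP).
Implicit Types x y z : Zp.

Lemma padic_natr_neq0 n : (n.+1%:R : Zp) != 0.
Proof.
apply/eqP => /(congr1 (fun z : Zp => padic_res z n.+1)).
rewrite padic_natE /= mod0n modn_small //.
by rewrite ltn_expl // prime_gt1.
Qed.

(** For the converse, write x - y = p^k u with u a unit: a zero n-th residue with k < n would make p
    divide u. *)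
Lemma padic_eqmodP n x y : padic_eqmod n x y <-> x n = y n.
Proof.
have resB : x n = y n <-> (x - y) n = 0%N.
  split=> [e|e].
    transitivity ((x - x : Zp) n); last by rewrite subrr /= mod0n.
    by rewrite /= e.
  rewrite -[x](subrK y); transitivity (((x - y)%R n + y n) %% p ^ n)%N; first by [].
  by rewrite e add0n padic_res_mod.
split=> [[z e]|/resB e].
  apply/resB; rewrite e.
  transitivity ((((p ^ n)%:R : Zp)%R n * z n) %% p ^ n)%N; first by [].
  by rewrite padic_natE modnn mul0n mod0n.
have [->|xy] := eqVneq x y; first exact: padic_eqmod_refl.
have [k [u uu xyE]] : exists k : nat,
  exists2 u : Zp, u \is a GRing.unit & x - y = p%:R ^+ k * u.
  by apply: padic_factor; rewrite subr_eq0.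
have [kn|nk] := ltnP k n; last first.
  exists (p%:R ^+ (k - n) * u); rewrite xyE mulrA natrX -exprD subnKC //.
have : (p ^ n %| p ^ k * u n)%N.
  move: e; rewrite xyE -natrX => e.
  have : ((((p ^ k)%:R : Zp)%R n * u n) %% p ^ n)%N = 0%N by exact: e.
  by rewrite padic_natE modnMml => /eqP.
rewrite -{1}(subnKC kn) addSnnS expnD dvdn_pmul2l ?padic_pgt0 // expnS => pu.
move: uu; rewrite padic_unitE.
have n0 : (0 < n)%N by apply: leq_ltn_trans kn.
rewrite -{1}(expn1 p) -(padic_dvd_res u n0) expn1.
by rewrite (dvdn_trans (dvdn_mulr _ (dvdnn p)) pu).
Qed.

Lemma padic_complete (x : nat -> Zp) :
  (forall n, padic_eqmod n (x n.+1) (x n)) ->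
  exists l, forall n, padic_eqmod n (x n) l.
Proof.
move=> xC; pose f n := x n n.
have fP n : (f n.+1 = f n %[mod p ^ n])%N.
  by rewrite /f -(proj1 (padic_eqmodP _ _ _) (xC n)) padic_coh.
exists (padic_mk pP fP) => n; apply/padic_eqmodP => /=.
by rewrite padic_res_mod.
Qed.

Lemma padic_eqmod_cvg (S : nat -> Zp) (l : Zp) :
  (forall n, padic_eqmod n (S n) l) -> S @ \oo --> l.
Proof.
move=> Sl A [n _ nA]; exists n => // N /= nN.
by apply: nA; apply: padic_eqmod_le (Sl N).
Qed.

Lemma padic_eqmod_separated x y : (forall n, padic_eqmod n x y) -> x = y.
Proof. by move=> xy; apply: padic_eqP => n; rewrite (proj1 (padic_eqmodP _ _ _) (xy n)). Qed.

Lemma horner_eqmod (P : {poly Zp}) n x y :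
  padic_eqmod n x y -> padic_eqmod n P.[x] P.[y].
Proof.
move=> [z xy]; have -> : x = y + (p ^ n)%:R * z by rewrite -xy addrC subrK.
elim/poly_ind: P => [|P c [w IH]]; first by rewrite !horner0; exact: padic_eqmod_refl.
exists (w * (y + (p ^ n)%:R * z) + P.[y] * z); rewrite !hornerE.
rewrite (_ : P.[y + _] = P.[y] + (p ^ n)%:R * w); first by ring.
by rewrite -IH; ring.
Qed.

(* [H`_0 = 1] makes [x |-> x - (x H(x) - a)] a contraction of [p Z_p]. *)
Lemma hensel_monic (H : {poly Zp}) (a : Zp) :
  H`_0 = 1 -> padic_eqmod 1 a 0 ->
  exists2 x, padic_eqmod 1 x 0 & x * H.[x] = a.
Proof.
move=> H0 [a' aE]; rewrite subr0 in aE.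
have [K HE] : exists K, H = 1 + 'X * K.
  exists (drop_poly 1 H); rewrite -[LHS](poly_take_drop 1) expr1 mulrC; congr (_ + _).
  by apply/polyP => -[|i]; rewrite coef_take_poly coef1.
pose Phi x := a - x ^+ 2 * K.[x].
have [x [xE0 xE]] : exists x : nat -> Zp, x 0%N = 0 /\ forall n, x n.+1 = Phi (x n).
  by exists (fun n => iter n Phi 0).
have x1 n : exists z, x n = p%:R * z.
  elim: n => [|n [z IH]]; first by exists 0; rewrite xE0 mulr0.
  exists (a' - z * x n * K.[x n]); rewrite xE /Phi aE expn1 expr2.
  move: (K.[x n]) => k; rewrite IH; ring.
have xC n : padic_eqmod n (x n.+1) (x n).
  elim: n => [|n IH]; first by exists (x 1%N - x 0%N); rewrite expn0 mul1r.
  have [u Ku] := horner_eqmod K IH.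
  have [z1 e1] := x1 n.+1; have [z0 e0] := x1 n; have [d dE] := IH.
  exists (- (d * (z1 + z0) * K.[x n.+1] + z0 * x n * u)).
  rewrite (xE n.+1) {2}(xE n) /Phi expnS natrM.
  (* Both summands gain a factor p over x_(n+1) - x_n, because the iterates are divisible by p. *)
  transitivity (- ((x n.+1 - x n) * (x n.+1 + x n) * K.[x n.+1]
                  + x n ^+ 2 * (K.[x n.+1] - K.[x n]))); first by ring.
  rewrite Ku dE; move: (K.[x n.+1]) => k; rewrite e1 e0; ring.
have [l xl] := padic_complete xC.
have lE : l = Phi l.
  apply: padic_eqmod_separated => n.
  apply: (padic_eqmod_trans (y := x n.+1)).
    apply/padic_eqmodP; apply/esym/padic_eqmodP.
    exact: padic_eqmod_le (leqnSn n) (xl n.+1).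
  have PhiE y : Phi y = (a%:P - 'X ^+ 2 * K).[y] by rewrite !hornerE.
  by rewrite xE !PhiE; apply: horner_eqmod.
exists l.
  apply: (padic_eqmod_trans (y := x 1%N)); last first.
    by have [z ->] := x1 1%N; exists z; rewrite subr0 expn1.
  by apply/padic_eqmodP; apply/esym/padic_eqmodP; exact: xl.
by rewrite HE !hornerE -[RHS](subrK (l ^+ 2 * K.[l])) -/(Phi l) -lE; ring.
Qed.

Lemma padic_val_unit x : padic_val (padic_of_int x) = 0%:E -> x \is a GRing.unit.
Proof.
have [->|x0] := eqVneq x 0; first by rewrite /padic_of_int rmorph0 padic_val0.
have [k [u uu ->]] := padic_factor x0.
have -> : padic_of_int (p%:R ^+ k * u) = p%:R ^ k%:Z * padic_of_int u.
  by rewrite /padic_of_int rmorphM rmorphXn rmorph_nat.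
rewrite padic_valE // => -[k0]; have -> : k = 0%N by [].
by rewrite expr0 mul1r.
Qed.

End PadicFacts.

(** * The terms of the series and the root *)

(** Factorial bookkeeping for [root_termE], with [c] = c_1^k, [N] = n+1, [nf] = n!, [kf] = k! and
    [C2] = C(n+k, k). *)
Lemma root_term_cancel (F : fieldType) (s c N nf kf C1 C2 h : F) :
  c != 0 -> N != 0 -> nf != 0 -> kf != 0 ->
  N * (s / (c * (N * nf)) * C1 * (C2 * (kf * nf) / kf * (c * h))) =
  s * (C2 * C1 * h).
Proof. by move=> c0 N0 nf0 kf0; field; rewrite c0 N0 nf0 kf0. Qed.

Section RootSeries.
Variables (p : nat) (pP : prime p) (f : {poly padic_int pP}) (r0 : int).
Local Notation Zp := (padic_int pP).

(** The divided derivative gives c_j inside Z_p, with no division by j!. *)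
Definition taylor_int j : Zp := f^`N(j).[r0%:~R].

(** The polynomial H with f(r0 + x) = c_0 + c_1 x H(x) when c_1 is a unit. *)
Definition shift_poly : {poly Zp} :=
  \poly_(i < size f) ((taylor_int 1)^-1 * taylor_int i.+1).

Lemma padic_frac_natr_neq0 n : (n.+1%:R : padic pP) != 0.
Proof.
by rewrite -(rmorph_nat (@FracField.tofrac Zp)) tofrac_eq0 padic_natr_neq0.
Qed.

Lemma taylor_coefE j : taylor_coef f r0 j = padic_of_int (taylor_int j).
Proof.
rewrite /taylor_coef /taylor_int nderivn_def hornerMn /padic_of_int rmorphMn /=.
by rewrite -mulr_natr mulfK // (fact_neq0 padic_frac_natr_neq0).
Qed.

Hypothesis c1U : taylor_int 1 \is a GRing.unit.

Lemma coef_shift_poly j : taylor_int 1 * shift_poly`_j = taylor_int j.+1.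
Proof.
rewrite coef_poly; case: ltnP => [_|jf]; first by rewrite mulVKr.
by rewrite mulr0 /taylor_int nderivn_poly0 ?horner0 // leqW.
Qed.

Lemma shift_poly0 : shift_poly`_0 = 1.
Proof. by apply: (mulrI c1U); rewrite coef_shift_poly mulr1. Qed.

Lemma horner_taylor_int x :
  f.[r0%:~R + x] = taylor_int 0 + taylor_int 1 * (x * shift_poly.[x]).
Proof.
rewrite (nderiv_taylor_wide (n := (size f).+1)) //; last exact: mulrC.
rewrite big_ord_recl expr0 mulr1 [shift_poly.[x]]horner_poly !mulr_sumr; congr (_ + _).
apply: eq_bigr => i _.
rewrite -/(taylor_int _) lift0 exprS !mulrA; congr (_ * _).
by rewrite [taylor_int 1 * x]mulrC mulrK // mulrC.
Qed.

(** Apply [partial_bellE] to h = c_1 X H, whose k-th power is c_1^k X^k H^k; the factor X^k shifts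
    the index n + k to n. *)
Lemma partial_bell_taylor n k :
  partial_bell (n + k) k (fun j => j`!%:R * taylor_coef f r0 j) =
  (n + k)`!%:R / k`!%:R *
    (taylor_coef f r0 1 ^+ k * padic_of_int ((shift_poly ^+ k)`_n)).
Proof.
pose i := @FracField.tofrac Zp.
pose h := map_poly i ((taylor_int 1)%:P * ('X * shift_poly)).
rewrite (@partial_bellE _ padic_frac_natr_neq0 _ _ _ h) ?leq_addl //; first last.
- by move=> [//|j] _; rewrite coef_map coefCM coefXM /= coef_shift_poly taylor_coefE.
- by rewrite coef_map coefCM coefXM /= mulr0 rmorph0.
congr (_ * _); rewrite taylor_coefE /padic_of_int.
rewrite -[map_poly _ _ ^+ _]rmorphXn coef_map !exprMn -polyC_exp coefCM coefXnM.
by rewrite ltnNge leq_addl addnK /= rmorphM rmorphXn.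
Qed.

(** [inv_coefE] determines (n + 1) b_n, so both sides are compared after multiplication by n + 1,
    which is invertible in Q_p. *)
Lemma root_termE n :
  root_term f r0 n =
  padic_of_int ((-1) ^+ n.+1 * inv_coef shift_poly n
                * (taylor_int 0 / taylor_int 1) ^+ n.+1).
Proof.
have nz := padic_frac_natr_neq0; have fz := fact_neq0 nz.
have i1 : taylor_coef f r0 1 != 0.
  by rewrite taylor_coefE tofrac_eq0; apply: contraTneq c1U => ->; rewrite unitr0.
rewrite /root_term /padic_of_int !rmorphM !rmorphXn rmorphN1 rmorphM rmorphV //=.
rewrite -![FracField.tofrac _]/(padic_of_int _) -!taylor_coefE; congr (_ * _).
apply: (mulfI (nz n)); rewrite [RHS]mulrCA -{2}(rmorph_nat (@FracField.tofrac Zp)).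
rewrite -rmorphM (inv_coefE (@padic_natr_neq0 _ pP) _ shift_poly0) rmorph_sum big_mkord.
rewrite !mulr_sumr; apply: eq_bigr => k _.
have : (k <= n)%N by rewrite -ltnS.
move: (nat_of_ord k) => {}k kn.
rewrite partial_bell_taylor.
rewrite [X in _ = _ * X]rmorphM [X in _ = _ * (X * _)]rmorphM rmorphXn rmorphN1 rmorph_nat.
rewrite /= -![FracField.tofrac _]/(padic_of_int _).
have -> : (-1) ^+ (n - k + 1) = (-1) ^+ n.+1 * (-1) ^+ k :> padic pP.
  rewrite (_ : n.+1 = n - k + 1 + k)%N; last by rewrite addnAC subnK ?addn1.
  by rewrite [X in _ = X * _]exprD -mulrA -expr2 sqrr_sign mulr1.
have bE := bin_fact (leq_addl n k); rewrite addnK in bE.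
rewrite -bE factS !natrM.
move: ((-1) ^+ n.+1) ((-1) ^+ k) => s1 s2.
rewrite root_term_cancel.
- by rewrite !mulrA.
- exact: expf_neq0.
- exact: nz.
- exact: fz.
- exact: fz.
Qed.

End RootSeries.

Theorem theorem3p1 (p : nat) (pP : prime p) (m : nat)
    (f : {poly padic_int pP}) (r0 : int) :
  (2 < p)%N ->
  size f = m.+1 ->
  padic_eqmod 1 f.[r0%:~R] 0 ->
  padic_val (padic_of_int (f^`()).[r0%:~R]) = 0%:E ->
  exists2 t : nat -> padic_int pP,
    forall n, padic_of_int (t n) = root_term f r0 n
    & exists r : padic_int pP,
      [/\ (fun N => r0%:~R + series t N) @ \oo --> r,
          root f r
        & padic_eqmod 1 r r0%:~R].
Proof.
move=> _ _ f0 f1.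
have c1U : taylor_int f r0 1 \is a GRing.unit.
  by rewrite /taylor_int nderivn1; apply: padic_val_unit.
have H0 := shift_poly0 c1U; set H := shift_poly f r0 in H0.
pose u := taylor_int f r0 0 / taylor_int f r0 1.
exists (fun n => (-1) ^+ n.+1 * inv_coef H n * u ^+ n.+1) => [n|].
  by rewrite root_termE.
have [z uE] : exists z, - u = p%:R * z.
  have [z e] := f0; exists (- (z / taylor_int f r0 1)).
  rewrite /u /taylor_int nderivn0; rewrite subr0 expn1 in e.
  by rewrite {1}e; ring.
have u1 : padic_eqmod 1 (- u) 0 by exists z; rewrite subr0 expn1.
have [x [y xE] Hx] := hensel_monic H0 u1; rewrite subr0 expn1 in xE.
exists (r0%:~R + x); split.
- apply: padic_eqmod_cvg => N.
  (* At x, where x H(x) = - u, the truncated inverse becomes the partial sum; its error contains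
     x^(N+1) = (p y)^(N+1). *)
  have := congr1 (fun P => P.[x]) (inv_coefP N H0).
  rewrite /= hornerD hornerX hornerM hornerXn horner_sum => e.
  exists (p%:R * y ^+ N.+1 * (inv_rem H N).[x]).
  have -> : series (fun n => (-1) ^+ n.+1 * inv_coef H n * u ^+ n.+1) N
    = x + x ^+ N.+1 * (inv_rem H N).[x].
    rewrite -e /series /= big_mkord; apply: eq_bigr => k _.
    by rewrite hornerZ horner_exp hornerM hornerX Hx [in RHS]exprNn mulrCA mulrA.
  rewrite natrX {2}xE exprMn exprS; ring.
- rewrite /root horner_taylor_int // -/H Hx /u mulrN mulrCA mulrV // mulr1 subrr.
  by [].
- by exists y; rewrite expn1 -xE; ring.
Qed.
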